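(* Let $X\in\mathcal{D}$, with quantile function $Q$ and quantile density $q$, and let $n\ge 1$ be an integer. If $g:(0,1)\to\mathbb{R}$ is $n$-times differentiable and $g^{(n)}\cdot Q$ is integrable on $(0,1)$, then $$E[\{g(1)-g(U)\}\,q(U)]=\sum_{k=1}^{n-1}\frac{1}{k!}E\left[g^{(k)}(U)(1-U)^k q(U)\right]+\frac{1}{(n-1)!}E\left[g^{(n)}(X^L)(1-X^L)^{n-1}\right]E[X],$$ where $U$ is uniformly distributed in $(0,1)$ and $X^L$ is an absolutely continuous random variable with values in $(0,1)$ and density $f_{X^L}(u)=Q(u)/E[X]$, $0<u<1$.
   Context: For a random variable $X$ with distribution function $F(x)=P(X\le x)$, the quantile function is $Q(u)=\inf\{x\in\mathbb{R}:F(x)\ge u\}$, $0<u<1$, and, if $Q$ is differentiable on $(0,1)$, the quantile density is $q(u)=Q'(u)$, $0<u<1$. $\mathcal{D}$ denotes the family of all absolutely continuous random variables with finite mean whose quantile function satisfies $Q(0)=0$ (where $Q(0):=\lim_{u\downarrow 0}Q(u)$) and whose quantile density exists on $(0,1)$; such random variables are nonnegative with finite nonzero mean. $g^{(k)}$ denotes the $k$-th derivative of $g$. The value $g(1)$ means $\lim_{u\uparrow 1}g(u)$. An empty sum is $0$. *)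

(* Defs.v *)
From HB Require Import structures.
From mathcomp Require Import all_boot all_order all_algebra.
From mathcomp Require Import all_classical all_reals all_analysis.

Set Implicit Arguments.
Unset Strict Implicit.
Unset Printing Implicit Defensive.

Import Order.TTheory GRing.Theory Num.Theory.
Import numFieldNormedType.Exports.

Local Open Scope ring_scope.
Local Open Scope classical_set_scope.

Definition quantile (d : measure_display) (T : measurableType d) (R : realType)
    (P : probability T R) (X : {RV P >-> R}) (u : R) : R :=
  inf [set x : R | (u%:E <= cdf X x)%E].

(* Only the values on ]0, 1[ are meaningful. *)
Definition quantile_density (d : measure_display) (T : measurableType d)
    (R : realType) (P : probability T R) (X : {RV P >-> R}) : R -> R :=
  derive1 (quantile X).

(* The family of absolutely continuous random variables with finite mean,
   Q(0) = 0 and a quantile density on ]0, 1[; absolute continuity is that of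
   the law of X with respect to Lebesgue measure. *)
Record in_classD (d : measure_display) (T : measurableType d) (R : realType)
    (P : probability T R) (X : {RV P >-> R}) : Prop := InClassD {
  classD_abs_cont : distribution P X `<< @lebesgue_measure R ;
  classD_mean : P.-integrable [set: T] (EFin \o X) ;
  classD_quantile0 : quantile X u @[u --> 0^'+] --> (0 : R) ;
  classD_quantile_density :
    forall u : R, 0 < u < 1 -> derivable (quantile X) u 1
}.

Definition has_density (d : measure_display) (T : measurableType d)
    (R : realType) (P : probability T R) (Y : {RV P >-> R}) (f : R -> R) : Prop :=
  forall A : set R, measurable A ->
    distribution P Y A = (\int[@lebesgue_measure R]_(x in A) (f x)%:E)%E.

(* A function on ]0, 1[ is represented by any extension to R: as ]0, 1[ is open,
   the values of derive1n k f on ]0, 1[ do not depend on the extension. *)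
Definition n_differentiable01 (R : realType) (n : nat) (f : R -> R) : Prop :=
  forall k, (k < n)%N -> forall u : R, 0 < u < 1 -> derivable (derive1n k f) u 1.

(* Main.v *)
Require Import Defs.
From HB Require Import structures.
From mathcomp Require Import all_boot all_order all_algebra.
From mathcomp Require Import all_classical all_reals all_analysis.
From mathcomp Require Import measurable_realfun ring lra.
Import Order.TTheory GRing.Theory Num.Theory.
Import numFieldNormedType.Exports.
Set Implicit Arguments.
Unset Strict Implicit.
Unset Printing Implicit Defensive.
Local Open Scope ring_scope.
Local Open Scope classical_set_scope.

(** Write mu for Lebesgue measure, Q for the quantile function of X and q = Q'.
The identity is a Taylor expansion of g at 1 with integral remainder, integrated
against q(u) du.  It rests on one exchange of integrals: if G is differentiable
on ]0, 1[ and G' Q is integrable, then q(u) G'(t) is integrable over the triangle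
0 < u <= t < 1, and, as the integral of q over ]0, t] is Q(t) and that of G' over
[u, 1[ is G(1) - G(u), the two orders of integration give
[[
   int_0^1 (G(1) - G(u)) q(u) du = int_0^1 G'(t) Q(t) dt      (weighted_integral).
]]
For G = g this is the case n = 1.  For 1 <= k < n it is applied to
G(u) = - g^(k)(u) (1 - u)^k / k!, which vanishes at 1 and whose derivative is a
difference of two consecutive terms of the same shape.  With
r_k = int_0^1 g^(k)(t) (1 - t)^(k-1) / (k-1)! Q(t) dt the outcome is
[[
   1/k! int_0^1 g^(k)(u) (1 - u)^k q(u) du = r_k - r_(k+1)    (taylor_term_integral),
]]
and the sum over k telescopes from r_1 = int_0^1 (g(1) - g) q to r_n.  Up to the
factor E[X], r_n is the expectation over X^L.  That E[X] is positive and Q is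
integrable follows from the density Q / E[X] having total mass 1 (lorenz_mass,
integrable_quantile).

All the integrals exist and all the limits at 1 are finite because integrability
against Q passes from G' to G (weighted_integrable_primitive): Q is nondecreasing,
so that Q(u) times the integral of |G'| over [u, 1[ is at most the integral of
|G'| Q.  Hence g^(k) Q is integrable for every k <= n, and every g^(k) with k < n
has a limit at 1, since Q is bounded below by a positive number away from 0.  The
positivity of Q is where absolute continuity enters: Q(u) = 0 would force an atom
of the law of X at 0 (quantile_gt0).

Neither q nor g^(n) is assumed continuous, so the formula
int_a^b F' = F(b) - F(a) is needed for every F that is differentiable everywhere
and has an integrable derivative (Rintegral_derive1).  Its core is an upper bound
of the increments of F by the integral of a majorant phi of F'
(increment_le_ge0_integral): phi is almost dominated near each point by a
function h with almost the same integral, so that the bound holds on small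
intervals, up to a multiple of their length, and it is additive over adjacent
intervals. *)

(** * Real-valued integrals *)

Section real_valued_integrals.
Context {R : realType}.
Local Notation mu := (@lebesgue_measure R).

Lemma RintegralN (D : set R) (f : R -> R) : measurable D ->
  mu.-integrable D (EFin \o f) ->
  \int[mu]_(x in D) (- f x) = - \int[mu]_(x in D) f x.
Proof.
move=> mD iD; rewrite -mulN1r -RintegralZl//.
by apply: eq_Rintegral => x _; rewrite mulN1r.
Qed.

Lemma integrable_oppr (D : set R) (f : R -> R) :
  mu.-integrable D (EFin \o f) -> mu.-integrable D (EFin \o (fun x => - f x)).
Proof.
move=> /integrableN; rewrite [X in _.-integrable _ X](_ : _ =
  EFin \o (fun x => - f x))//.
Qed.

Lemma integrable_scalel (D : set R) (c : R) (f : R -> R) : measurable D ->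
  mu.-integrable D (EFin \o f) -> mu.-integrable D (EFin \o (fun u => c * f u)).
Proof.
move=> mD iD; rewrite (_ : EFin \o _ = (fun t => c%:E * (EFin \o f) t)%E)//.
exact: integrableZl.
Qed.

Lemma integrable_subr (D : set R) (f g : R -> R) : measurable D ->
  mu.-integrable D (EFin \o f) -> mu.-integrable D (EFin \o g) ->
  mu.-integrable D (EFin \o (fun u => f u - g u)).
Proof.
move=> mD fD gD; rewrite (_ : EFin \o _ = (EFin \o f) \- (EFin \o g))%E//.
exact: integrableB.
Qed.

Lemma itv_cc_lty a b : (mu `[a, b] < +oo)%E.
Proof. by rewrite lebesgue_measure_itv/= lte_fin; case: ifP => // _; rewrite -EFinB ltry. Qed.

Lemma ge0_integral_itv_cat (h : R -> \bar R) a b c : a <= b -> b <= c ->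
  measurable_fun setT h -> (forall x, 0 <= h x)%E ->
  (\int[mu]_(x in `[a, c]) h x =
   \int[mu]_(x in `[a, b]) h x + \int[mu]_(x in `[b, c]) h x)%E.
Proof.
move=> ab bc mh h0.
rewrite (@itv_bndbnd_setU _ _ _ (BRight b)) ?bnd_simp//.
rewrite ge0_integral_setU//=.
- by rewrite integral_itv_obnd_cbnd//; exact: measurable_funTS.
- exact: measurable_funTS.
- apply/disj_set2P; rewrite -subset0 => z/=; rewrite !in_itv/= => -[/andP[_]].
  by rewrite leNgt => /negbTE ->.
Qed.

End real_valued_integrals.

(** * Everywhere differentiable functions *)

Section derivative.
Context {R : realType}.
Implicit Types (f F : R -> R) (a b : R).

Lemma measurable_derivable_itv f a b :
  (forall x, a < x < b -> derivable f x 1) -> measurable_fun `]a, b[ f.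
Proof.
move=> df; apply: open_continuous_measurable_fun; first exact: interval_open.
move=> x; rewrite inE/= in_itv/= => /df /derivable1_diffP.
exact: differentiable_continuous.
Qed.

Lemma derivable_cvg f x : derivable f x 1 ->
  h^-1 * (f (h + x) - f x) @[h --> 0^'] --> (derive1 f x : R).
Proof.
move=> dfx; rewrite derive1E /derive; move: dfx; rewrite /derivable.
set u := (X in cvg (X @ _)) => cu; rewrite [X in X @ _ --> _](_ : _ = u) //.
by apply/funext => h; rewrite /u/= [h%:A]mulr1.
Qed.

(** The derivative is the pointwise limit of difference quotients of step
1 / (n + 1); extending f by 0 makes these quotients measurable on the whole line,
and at each point they eventually stay inside ]a, b[. *)
Lemma measurable_derive1_itv f a b :
  (forall x, a < x < b -> derivable f x 1) -> measurable_fun `]a, b[ (derive1 f).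
Proof.
move=> df; pose f0 := f \_ `]a, b[.
have mf0 : measurable_fun setT f0.
  by apply/(measurable_restrictT f) => //; exact: measurable_derivable_itv.
pose h n (x : R) := n.+1%:R * (f0 (n.+1%:R^-1 + x) - f0 x).
apply: (@measurable_fun_cvg _ _ _ `]a, b[%classic h).
  move=> n; apply: measurable_funTS; apply: measurable_funM => //.
  apply: measurable_funB => //; apply: (measurableT_comp mf0) => //.
  exact: measurable_funD.
move=> x; rewrite /= in_itv/= => xab; have := derivable_cvg (df _ xab).
have bx0 : 0 < b - x by case/andP: xab => _; rewrite subr_gt0.
move=> /cvgr_dnbhsP /(_ harmonic); set u := fun n => _.
have /[swap] /[apply] : (forall n, @harmonic R n != 0) /\ @harmonic R @ \oo --> 0.
  by split; [move=> n; rewrite gt_eqF// harmonic_gt0|exact: cvg_harmonic].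
apply: cvg_trans; apply: near_eq_cvg; near=> n.
rewrite /h/= invrK; congr (_ * _).
rewrite /f0 !patchE !ifT//.
  by rewrite inE/= in_itv.
rewrite inE/= in_itv/=; move: xab => /andP[ax xb].
rewrite (lt_trans ax) ?ltrDr//=.
rewrite -ltrBrDr.
by near: n; exact: (near_infty_natSinv_lt (PosNum bx0)).
Unshelve. all: by end_near. Qed.

Lemma derivable_near f (x : R) : derivable f x 1 -> forall e : R, 0 < e ->
  \forall y \near x, `|f y - f x - derive1 f x * (y - x)| <= e * `|y - x|.
Proof.
move=> /derivable_cvg/cvgrPdist_le dfx e e0.
have := dfx _ e0; rewrite near_withinE => /nbhs_ballP[d /= d0 dP].
apply/nbhs_ballP; exists d => //= y; rewrite /ball/= => xyd.
have [->|yx] := eqVneq y x; first by rewrite !subrr mulr0 subrr normr0 mulr0.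
have := dP (y - x); rewrite /ball/= sub0r normrN distrC => /(_ xyd).
rewrite subr_eq0 => /(_ yx); rewrite subrK => H.
have yx0 : y - x != 0 by rewrite subr_eq0.
rewrite [X in `|X| <= _](_ : _ =
    ((y - x)^-1 * (f y - f x) - derive1 f x) * (y - x)); last by field.
by rewrite normrM [`|x - y|]distrC ler_wpM2r// distrC.
Qed.

(** The increment is taken over an interval [u, v] that contains x, not from x:
this is what lets a local bound be glued along arbitrary subdivisions. *)
Lemma derivable_straddle f x : derivable f x 1 -> forall e : R, 0 < e ->
  exists2 d : R, 0 < d & forall u v, x - d < u -> u <= x -> x <= v -> v < x + d ->
    f v - f u <= (derive1 f x + e) * (v - u).
Proof.
move=> dfx e e0; have /nbhs_ballP[d /= d0 dP] := derivable_near dfx e0.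
exists d => // u v xdu ux xv vxd.
have Hv : `|f v - f x - derive1 f x * (v - x)| <= e * `|v - x|.
  by apply: dP; rewrite /ball/= distrC ger0_norm; lra.
have Hu : `|f u - f x - derive1 f x * (u - x)| <= e * `|u - x|.
  by apply: dP; rewrite /ball/= ger0_norm; lra.
move: Hv Hu; rewrite (ger0_norm (_ : 0 <= v - x)) ?subr_ge0//.
rewrite (ler0_norm (_ : u - x <= 0)) ?subr_le0//.
by rewrite !ler_norml => /andP[_ ?] /andP[? _]; lra.
Qed.

Lemma nondecreasing_derive1_ge0 F a b (x : R) :
  (forall u v, a < u -> u <= v -> v < b -> F u <= F v) ->
  a < x < b -> derivable F x 1 -> 0 <= derive1 F x.
Proof.
move=> ndF /andP[ax xb] dF; rewrite leNgt; apply/negP => F0.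
have e0 : 0 < - derive1 F x / 2 by rewrite divr_gt0// oppr_gt0.
have [d d0 strad] := derivable_straddle dF e0.
pose v := x + Num.min d (b - x) / 2.
have m0 : 0 < Num.min d (b - x) by rewrite lt_min d0 subr_gt0.
have m1 : Num.min d (b - x) <= d by rewrite ge_min lexx.
have m2 : Num.min d (b - x) <= b - x by rewrite ge_min lexx orbT.
have xv : x < v by rewrite /v ltrDl divr_gt0.
have vb : v < b by rewrite /v; lra.
have vd : v < x + d by rewrite /v; lra.
have := strad x v ltac:(lra) (lexx _) (ltW xv) vd.
have := ndF x v ax (ltW xv) vb.
have : (derive1 F x + - derive1 F x / 2) * (v - x) < 0.
  by rewrite nmulr_rlt0 ?subr_gt0//; lra.
lra.
Qed.

End derivative.

Section itv_induction.
Context {R : realType}.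
Variable P : R -> R -> Prop.
Hypothesis Ptr : forall x y z, x <= y -> y <= z -> P x y -> P y z -> P x z.

(** Let s be the supremum of the points x with P a x.  The local hypothesis at s
first glues a point just below s to s, then s to a point above it, which is
impossible unless s = b. *)
Lemma itv_additive_induction a b : a <= b ->
  (forall x, a <= x <= b -> exists2 d : R, 0 < d &
    forall u v, a <= u -> x - d < u -> u <= x -> x <= v -> v < x + d -> v <= b ->
     P u v) ->
  P a b.
Proof.
move=> ab loc.
pose S := [set x | a <= x <= b /\ P a x].
have Sa : S a.
  rewrite /S/= lexx ab; split => //.
  by have [|d d0] := loc a; [rewrite lexx|apply => //; lra].
have supS : has_sup S by split; [exists a|exists b => x [/andP[]]].
set s := sup S.
have as_ : a <= s by apply: ub_le_sup => //; exact: supS.2.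
have sb : s <= b by apply: ge_sup; [exists a|move=> x [/andP[]]].
have [|d d0 dP] := loc s; first exact/andP.
have [c Sc sdc] := sup_adherent d0 supS.
have [/andP[ac cb] Pac] := Sc.
have cs : c <= s by apply: ub_le_sup => //; exact: supS.2.
pose v := Num.min b (s + d / 2).
have sv : s <= v by rewrite /v le_min sb/=; lra.
have vb : v <= b by rewrite /v ge_min lexx.
have vd : v < s + d.
  by apply: (@le_lt_trans _ _ (s + d / 2)); [rewrite /v ge_min lexx orbT|lra].
have Pav : P a v.
  by apply: (Ptr ac (le_trans cs sv) Pac); exact: dP.
have [bv|] := leP b (s + d / 2).
  by move: Pav; rewrite /v min_l.
move=> vlt; suff: v <= s by rewrite /v min_r ?(ltW vlt)//; lra.
apply: ub_le_sup; first exact: supS.2.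
by split => //; rewrite vb andbT (le_trans as_).
Qed.
End itv_induction.

(** * The integral of a derivative that need not be continuous *)

Section upper_function.
Context {R : realType}.
Local Notation mu := (@lebesgue_measure R).
Local Open Scope ereal_scope.

(** Slice D into the level sets E k where k eta <= phi < (k + 1) eta, enlarge each of
them to an open set V k, and let h be the sum of the k eta times the indicators
of the V k.  Openness makes h at least k eta in a neighbourhood of every point of
E k.  The excess measure of V k is so small that all of them together add at most
eps to the integral. *)
Lemma ge0_exists_open_levels_above (D : set R) (phi : R -> R) (eta eps : R) :
  measurable D -> mu D < +oo -> measurable_fun D phi ->
  (forall x, D x -> (0 <= phi x)%R) -> (0 < eta)%R -> (0 < eps)%R ->
  exists h : R -> \bar R, [/\ measurable_fun setT h, forall x, 0 <= h x,
    \int[mu]_(x in D) h x <= \int[mu]_(x in D) (phi x)%:E + eps%:E &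
    forall x, D x -> exists r : R, [/\ (0 <= r)%R, (phi x <= r + eta)%R &
      \forall t \near x, r%:E <= h t]].
Proof.
move=> mD Dfin mphi phi0 eta0 eps0.
pose E k := D `&` phi @^-1` `[(k%:R * eta)%R, (k.+1%:R * eta)%R[.
(* Multiplied by k * eta, the excess d k is at most eps / 2 ^ k.+1; the factor
   k.+1 rather than k avoids a division by 0. *)
pose d k : R := (eps / (2 ^ k.+1)%:R / (k.+1%:R * eta))%R.
have mE k : measurable (E k) by exact: mphi.
have d0 k : (0 < d k)%R by rewrite !divr_gt0// mulr_gt0.
have Efin k : mu (E k) < +oo.
  apply: le_lt_trans Dfin; apply: le_measure; rewrite ?inE//; first exact: mE.
  exact: subIsetl.
have [V VP] : {V : nat -> set R & forall k,
    [/\ open (V k), E k `<=` V k & mu (V k `\` E k) < (d k)%:E]}.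
  apply: (@choice _ _ (fun k V => [/\ open V, E k `<=` V & mu (V `\` E k) < (d k)%:E])).
  by move=> k; apply: lebesgue_regularity_outer; [exact: mE|exact: Efin|exact: d0].
have mV k : measurable (V k) by have [oV _ _] := VP k; exact: open_measurable.
pose F k (t : R) := (k%:R * eta)%:E * (\1_(V k) t)%:E.
have F0 k t : 0 <= F k t by rewrite mule_ge0// lee_fin// mulr_ge0// ltW.
have mF k (A : set R) : measurable_fun A (F k).
  by apply: emeasurable_funM => //; apply/measurable_EFinP.
have mf : measurable_fun D (EFin \o phi) by exact/measurable_EFinP.
have DE : D = \bigcup_k E k.
  apply/seteqP; split => [x Dx|x [k _ []//]].
  have x0 : (0 <= phi x / eta)%R by rewrite divr_ge0 ?phi0 ?ltW.
  exists (Num.truncn (phi x / eta)%R) => //; split => //=.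
  rewrite in_itv/= -ler_pdivlMr// -ltr_pdivrMr//.
  exact: truncn_itv.
exists (fun t => \sum_(0 <= k <oo) F k t); split.
- apply: ge0_emeasurable_sum => //; by move=> *; exact: mF.
- by move=> x; exact: nneseries_ge0.
- rewrite integral_nneseries//; last by move=> k; exact: mF.
  apply: (@le_trans _ _ (\sum_(0 <= k <oo)
      (\int[mu]_(x in E k) (phi x)%:E + (eps / (2 ^ k.+1)%:R)%:E))); last first.
    apply: le_trans (epsilon_trick _ _ (ltW eps0)) _.
      by move=> k; apply: integral_ge0 => x [/phi0]; rewrite lee_fin.
    rewrite leeD2r// [X in _ <= X](_ : _ =
      \int[mu]_(x in \bigcup_k E k) (phi x)%:E) -?DE// DE ge0_integral_bigcup//.
    + by rewrite -DE.
    + by move=> x [k _ [/phi0 ? _]]; rewrite lee_fin.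
    + apply/trivIsetP => i j _ _ ij; rewrite -subset0 => x [[_ /=]].
      rewrite in_itv/= => /andP[xi1 xi2] [_ /=]; rewrite in_itv/= => /andP[xj1 xj2].
      have := le_lt_trans xi1 xj2; have := le_lt_trans xj1 xi2.
      rewrite !ltr_pM2r// !ltr_nat !ltnS => ji ij'.
      by move: ij; rewrite eqn_leq ij' ji.
  apply: lee_nneseries => [k _ _|k _]; first by apply: integral_ge0 => x _; exact: F0.
  have k0 : (0 <= k%:R * eta :> R)%R by rewrite mulr_ge0// ltW.
  have mVk := mV k.
  rewrite /F ge0_integralZl//; last by apply/measurable_EFinP; exact: measurable_indic.
  rewrite integral_indic//.
  apply: (@le_trans _ _ ((k%:R * eta)%:E * (mu (E k) + (d k)%:E))).
    rewrite lee_wpmul2l//.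
    have [_ EV VE] := VP k.
    apply: (@le_trans _ _ (mu (V k))).
      by apply: le_measure; rewrite ?inE//; exact: measurableI mVk mD.
    rewrite -{1}(setDKU EV).
    apply: (le_trans (@measureU2 _ _ _ mu _ _ (measurableD (mV k) (mE k)) (mE k))).
    by rewrite addeC leeD2l// ltW.
  rewrite ge0_muleDr//; last by rewrite lee_fin ltW.
  apply: leeD.
    rewrite -integral_cst; last exact: mE.
    apply: ge0_le_integral; first exact: mE.
    + by move=> x _ /=; rewrite lee_fin.
    + exact: measurable_cst.
    + by apply: (measurable_funS mD) => //; exact: subIsetl.
    + by move=> x [_ /=]; rewrite in_itv/= => /andP[? _]; rewrite lee_fin.
  rewrite -EFinM lee_fin /d; set A := (eps / _)%R.
  have A0 : (0 <= A)%R by rewrite divr_ge0// ltW.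
  rewrite mulrC -mulrA ler_piMr//.
  rewrite mulrC ler_pdivrMr ?mul1r ?mulr_gt0//.
  by rewrite ler_pM2r// ler_nat.
- move=> x Dx; have [k _ [_ /=]] : (\bigcup_k E k) x by rewrite -DE.
  rewrite in_itv/= => /andP[kx xk].
  exists (k%:R * eta)%R; split.
  + by rewrite mulr_ge0// ltW.
  + by apply: ltW; apply: lt_le_trans xk _; rewrite -natr1 mulrDl mul1r.
  + have [oV EV _] := VP k.
    have Vx : V k x by apply: EV; split => //=; rewrite in_itv/= kx.
    near=> t.
    have Vt : V k t by near: t; exact: open_nbhs_nbhs.
    apply: le_trans (nneseries_lim_ge k.+1 _) => //.
    rewrite big_nat_recr//= {2}/F indicE mem_set// mule1 leeDr//.
    exact: sume_ge0.
Unshelve. all: by end_near. Qed.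

End upper_function.

Section derivative_bound.
Context {R : realType}.
Local Notation mu := (@lebesgue_measure R).
Implicit Types (F phi : R -> R) (a b : R).

(** The bound holds up to 2 eta (v - u) on every short interval [u, v] around a
point x: one eta is lost between F v - F u and the derivative at x, the other one
between phi x and the value that h dominates near x. *)
Lemma increment_le_ge0_integral F phi a b : a <= b ->
  (forall x, a <= x <= b -> derivable F x 1) ->
  (forall x, a <= x <= b -> derive1 F x <= phi x) ->
  measurable_fun `[a, b] phi -> (forall x, a <= x <= b -> 0 <= phi x) ->
  ((F b - F a)%:E <= \int[mu]_(x in `[a, b]) (phi x)%:E)%E.
Proof.
move=> ab dF Fphi mphi phi0; apply/lee_addgt0Pr => e e0.
(* So that 2 * eta * (b - a) <= e / 2; the + 1 keeps the denominator positive
   when a = b. *)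
pose eta := e / (4 * (b - a + 1)).
have ba1 : 0 < b - a + 1 by lra.
have eta0 : 0 < eta by rewrite divr_gt0// mulr_gt0.
have e20 : 0 < e / 2 by rewrite divr_gt0.
have [h [mh h0 hphi hloc]] := ge0_exists_open_levels_above
  (measurable_itv _) (itv_cc_lty a b) mphi phi0 eta0 e20.
pose P u v := ((F v - F u)%:E <=
  \int[mu]_(x in `[u, v]) h x + (2 * eta * (v - u))%:E)%E.
suff: P a b.
  move=> /le_trans; apply.
  rewrite [e in leRHS]splitr EFinD addeA leeD// lee_fin.
  have -> : e / 2 = 2 * eta * (b - a + 1) by rewrite /eta; field; rewrite gt_eqF.
  rewrite ler_pM2l; first by rewrite lerDl.
  by rewrite mulr_gt0.
apply: (@itv_additive_induction _ P _ a b ab) => [x y z xy yz|x xab].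
  rewrite /P => Pxy Pyz.
  rewrite (ge0_integral_itv_cat xy yz)//.
  have -> : F z - F x = (F y - F x) + (F z - F y) by ring.
  have -> : 2 * eta * (z - x) = 2 * eta * (y - x) + 2 * eta * (z - y) by ring.
  rewrite (EFinD (F y - F x)) (EFinD (2 * eta * (y - x))) addeACA.
  exact: leeD.
have [r [r0 phir /nbhs_ballP[d1 /= d10 hr]]] := hloc x xab.
have [d2 d20 strad] := derivable_straddle (dF x xab) eta0.
exists (Num.min d1 d2); first by rewrite lt_min d10.
move=> u v au xu ux xv vx vb.
have m1 : Num.min d1 d2 <= d1 by rewrite ge_min lexx.
have m2 : Num.min d1 d2 <= d2 by rewrite ge_min lexx orbT.
have /= FuvE := strad u v ltac:(lra) ux xv ltac:(lra).
have uv : u <= v by exact: le_trans xv.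
have rh : ((r * (v - u))%:E <= \int[mu]_(y in `[u, v]) h y)%E.
  apply: (@le_trans _ _ (\int[mu]_(y in `[u, v]) r%:E)%E).
    rewrite integral_cst//= lebesgue_measure_itv/= lte_fin.
    case: ltP => [_|vu]; first by rewrite -EFinB -EFinM.
    by rewrite mule0 lee_fin (_ : v - u = 0) ?mulr0//; lra.
  apply: ge0_le_integral => //.
  - exact: measurable_funTS.
  - move=> y /=; rewrite in_itv/= => /andP[uy yv].
    by apply: hr; rewrite /ball/= ltr_norml; apply/andP; split; lra.
rewrite /P; apply: le_trans (leeD2r _ rh).
rewrite -EFinD lee_fin (le_trans FuvE)// -mulrDl ler_wpM2r ?subr_ge0//.
by have := Fphi _ xab; lra.
Qed.

Lemma is_derive_add_linear F x (c : R) : derivable F x 1 ->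
  is_derive x (1 : R) (fun y => F y + c * y) (derive1 F x + c).
Proof.
move=> dF.
have := is_deriveD (derivableP dF) (is_deriveZ c (is_derive_id x (1 : R))).
by rewrite derive1E [_ *: _]mulr1.
Qed.

(** Truncating phi from below at - n and adding the linear function n y to F
reduces to a nonnegative majorant; the truncation is then removed by dominated
convergence. *)
Lemma increment_le_integral F phi a b : a <= b ->
  (forall x, a <= x <= b -> derivable F x 1) ->
  (forall x, a <= x <= b -> derive1 F x <= phi x) ->
  mu.-integrable `[a, b] (EFin \o phi) ->
  F b - F a <= \int[mu]_(x in `[a, b]) phi x.
Proof.
move=> ab dF Fphi iphi.
have mphi : measurable_fun `[a, b] phi.
  by apply/measurable_EFinP; exact: measurable_int iphi.
pose f n x := (Num.max (phi x) (- n%:R)).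
have mf n : measurable_fun `[a, b] (f n) by exact: measurable_maxr.
have mEf n : measurable_fun `[a, b] (EFin \o f n) by apply/measurable_EFinP.
have le_f n : ((F b - F a)%:E <= \int[mu]_(x in `[a, b]) (f n x)%:E)%E.
  have inf : mu.-integrable `[a, b] (EFin \o f n).
    apply: le_integrable iphi; [exact: measurable_itv|exact: mEf|move=> x _ /=].
    rewrite lee_fin /f /Num.max; case: ifPn => // phin.
    by rewrite normrN ger0_norm// ler_normr lerNr (ltW phin) orbT.
  have := @increment_le_ge0_integral (fun y => F y + n%:R * y)
    (fun x => f n x + n%:R) a b ab.
  have icst : mu.-integrable `[a, b] (EFin \o cst (n%:R : R)).
    by apply: measurable_bounded_integrable => //; [exact: itv_cc_lty|exact: bounded_cst].
  under [X in _ -> _ -> _ -> _ -> (_ <= X)%E]eq_integral do rewrite EFinD.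
  rewrite integralD//= integral_cst//=.
  have -> : (mu `[a, b] = (b - a)%:E)%E.
    rewrite lebesgue_measure_itv/= lte_fin; case: ltP => // ba.
    by rewrite (_ : b - a = 0)//; lra.
  rewrite -EFinM -leeBlDr// -EFinB.
  rewrite (_ : F b + _ - _ - _ = F b - F a); last by ring.
  apply.
  - by move=> x /dF/(@is_derive_add_linear _ _ n%:R)[].
  - move=> x xab; have dFn := is_derive_add_linear n%:R (dF x xab).
    rewrite derive1E derive_val.
    by rewrite lerD2r /f le_max Fphi.
  - exact: measurable_funD (mf n) (measurable_cst _).
  - by move=> x _; rewrite /f -lerBlDr sub0r le_max lexx orbT.
rewrite -lee_fin /Rintegral fineK; last exact: integrable_fin_num.
have [] := @dominated_convergence _ _ _ mu `[a, b] (measurable_itv _)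
  (fun n => EFin \o f n) (EFin \o phi) (abse \o (EFin \o phi)).
- exact: mEf.
- exact/measurable_EFinP.
- apply: aeW => x _; apply: cvg_near_cst.
  near=> n; rewrite /f/= max_l// lerNl.
  by near: n; exact: nbhs_infty_ger.
- exact: integrable_abse.
- apply: aeW => x n _; rewrite /= lee_fin /f /Num.max; case: ifPn => // phin.
  by rewrite normrN ger0_norm// ler_normr lerNr (ltW phin) orbT.
move=> _ _ cvI; rewrite -(cvg_lim (@ereal_hausdorff R) cvI).
apply: lime_ge; first by apply/cvg_ex; eexists; exact: cvI.
exact: nearW.
Unshelve. all: by end_near. Qed.

Lemma integral_le_increment F phi a b : a <= b ->
  (forall x, a <= x <= b -> derivable F x 1) ->
  (forall x, a <= x <= b -> phi x <= derive1 F x) ->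
  mu.-integrable `[a, b] (EFin \o phi) ->
  \int[mu]_(x in `[a, b]) phi x <= F b - F a.
Proof.
move=> ab dF phiF iphi.
have dNF x : a <= x <= b -> derivable (- F) x 1.
  by move=> /dF; exact: derivableN.
have phiNF x : a <= x <= b -> derive1 (- F) x <= - phi x.
  move=> xab; rewrite derive1E deriveN; last exact: dF.
  by rewrite -derive1E lerN2 phiF.
have := increment_le_integral ab dNF phiNF (integrable_oppr iphi).
rewrite RintegralN// lerNr => /le_trans; apply.
have -> : - ((- F) b - (- F) a) = F b - F a.
  by rewrite opprB [LHS]addrC; congr (_ + _); exact: opprK.
exact: lexx.
Qed.

Lemma Rintegral_derive1 F a b : a <= b ->
  (forall x, a <= x <= b -> derivable F x 1) ->
  mu.-integrable `[a, b] (EFin \o derive1 F) ->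
  \int[mu]_(x in `[a, b]) derive1 F x = F b - F a.
Proof.
move=> ab dF iF; apply/eqP; rewrite eq_le.
by rewrite integral_le_increment ?increment_le_integral.
Qed.

(** The truncations min(F', n) are integrable minorants of F', so their integrals are
at most F b - F a, and monotone convergence passes this bound to F'. *)
Lemma ge0_integrable_derive1 F a b : a <= b ->
  (forall x, a <= x <= b -> derivable F x 1) ->
  (forall x, a <= x <= b -> 0 <= derive1 F x) ->
  measurable_fun `[a, b] (derive1 F) ->
  mu.-integrable `[a, b] (EFin \o derive1 F).
Proof.
move=> ab dF F0 mF.
pose f n x := Num.min (derive1 F x) n%:R.
have mf n : measurable_fun `[a, b] (f n) by exact: measurable_minr.
have f0 n x : `[a, b] x -> 0 <= f n x.
  by rewrite /= in_itv/= => xab; rewrite /f le_min F0//=.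
have fn n x : f n x <= n%:R by rewrite /f ge_min lexx orbT.
have inf n : mu.-integrable `[a, b] (EFin \o f n).
  apply: measurable_bounded_integrable; [exact: measurable_itv|exact: itv_cc_lty|exact: mf|].
  exists n%:R; split => // M nM x xab.
  by rewrite /= ger0_norm ?f0// (le_trans (fn n x))// ltW.
have le_f n : (\int[mu]_(x in `[a, b]) (EFin \o f n) x <= (F b - F a)%:E)%E.
  rewrite -[leLHS]fineK; last exact: integrable_fin_num (inf n).
  rewrite lee_fin; apply: integral_le_increment => // x _.
  by rewrite /f ge_min lexx.
have nd_f x : `[a, b] x -> nondecreasing_seq (fun n => (EFin \o f n) x).
  move=> _ m n mn; rewrite lee_fin /f le_min ge_min lexx/=.
  by rewrite ge_min ler_nat mn orbT.
have limf x : `[a, b] x -> limn (fun n => (EFin \o f n) x) = (derive1 F x)%:E.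
  move=> xab; apply: cvg_lim => //; apply: cvg_near_cst.
  near=> n; rewrite /= /f min_l//.
  by near: n; exact: nbhs_infty_ger.
have cvI := @cvg_monotone_convergence _ _ _ mu `[a, b] (measurable_itv _)
  (fun n => EFin \o f n) (fun n => (measurable_EFinP _ _).2 (mf n))
  (fun n x xab => f0 n x xab) nd_f.
have leF : (\int[mu]_(x in `[a, b]) (EFin \o derive1 F) x <= (F b - F a)%:E)%E.
  rewrite [leLHS](_ : _ = limn (fun n => \int[mu]_(x in `[a, b]) (EFin \o f n) x))%E.
    apply: lime_le; last exact: nearW.
    by apply/cvg_ex; eexists; exact: cvI.
  rewrite (cvg_lim (@ereal_hausdorff R) cvI).
  by apply: eq_integral => x; rewrite inE => /limf ->.
have mEF : measurable_fun `[a, b] (EFin \o derive1 F) by exact/measurable_EFinP.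
apply/integrableP; split; first exact: mEF.
apply: le_lt_trans (le_lt_trans leF (ltry _)).
apply: ge0_le_integral; first exact: measurable_itv.
- by move=> x _; exact: abse_ge0.
- by apply: measurableT_comp => //; exact: mEF.
- exact: mEF.
- move=> x; rewrite /= in_itv/= => xab.
  by rewrite lee_fin ger0_norm ?F0.
Unshelve. all: by end_near. Qed.
End derivative_bound.

(** * Half-open intervals and integration over a triangle *)

Section open_interval.
Context {R : realType}.
Local Notation mu := (@lebesgue_measure R).
Implicit Types (G Q w psi : R -> R) (a b x : R).

(** Integrability of G' up to b is what makes G converge at b: the increments of G
are indefinite integrals of G', which are continuous in their upper bound. *)
Lemma cvg_at_left_derive1_integral G x b : x < b ->
  (forall y, x <= y < b -> derivable G y 1) ->
  mu.-integrable `[x, b[ (EFin \o derive1 G) ->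
  G u @[u --> b^'-] --> G x + \int[mu]_(t in `[x, b[) derive1 G t.
Proof.
move=> xb dG iG.
pose f := (derive1 G) \_ `[x, b[.
have fE D : D `<=` `[x, b[ ->
    \int[mu]_(t in D) f t = \int[mu]_(t in D) derive1 G t.
  move=> Dx; apply: eq_Rintegral => t; rewrite inE => /Dx xtb.
  by rewrite /f patchE mem_set.
have iff : mu.-integrable `[x, b] (EFin \o f).
  rewrite -restrict_EFin; apply/integrable_restrict => //=.
  by rewrite setIidr//; apply: subset_itvl; rewrite bnd_simp.
have ifb : mu.-integrable `[x, b[ (EFin \o f).
  by apply: integrableS iff => //; apply: subset_itvl; rewrite bnd_simp.
rewrite -fE// Rintegral_itv_bndo_bndc//.
have := parameterized_integral_cvg_at_left xb iff.
move=> /(cvgD (cvg_cst (G x))); apply: cvg_trans; apply: near_eq_cvg.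
near=> u; rewrite /= /parameterized_integral.
have xu : x <= u by near: u; exact: nbhs_left_ge.
have ub : u < b by near: u; exact: nbhs_left_lt.
have sub : `[x, u] `<=` `[x, b[ by apply: subset_itvl; rewrite bnd_simp.
suff E : G x + \int[mu]_(t in `[x, u]) f t = G u by [].
rewrite fE// Rintegral_derive1//.
- by rewrite addrC subrK.
- by move=> y /andP[xy yu]; apply: dG; rewrite xy (le_lt_trans yu).
- exact: integrableS iG.
Unshelve. all: by end_near. Qed.

(** Integrability up to a comes for free from the sign of the derivative: the
integrals over the intervals [s n, t] increase to the integral over their union
]a, t]. *)
Lemma integral_derive1_from_left Q a b t : a < t < b ->
  (forall y, a < y < b -> derivable Q y 1) ->
  (forall y, a < y < b -> 0 <= derive1 Q y) ->
  Q u @[u --> a^'+] --> (0 : R) ->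
  (\int[mu]_(u in `]a, t]) (derive1 Q u)%:E = (Q t)%:E)%E.
Proof.
move=> /andP[at_ tb] dQ Q0 Qa.
pose s n := a + (t - a) / n.+1%:R.
have ta0 : 0 < t - a by rewrite subr_gt0.
have as_ n : a < s n by rewrite /s ltrDl divr_gt0.
have st n : s n <= t.
  by rewrite /s -lerBrDl ler_pdivrMr// ler_peMr ?ler1n// ltW.
have mQ : measurable_fun `]a, b[ (derive1 Q) by exact: measurable_derive1_itv.
have sub : `]a, t] `<=` `]a, b[ by apply: subset_itvl; rewrite bnd_simp.
have subn n : `[s n, t] `<=` `]a, t].
  by apply: subset_itvr; rewrite bnd_simp.
have stE n : (\int[mu]_(u in `[s n, t]) (derive1 Q u)%:E = (Q t - Q (s n))%:E)%E.
  have D y : s n <= y <= t -> a < y < b.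
    by move=> /andP[sy yt]; rewrite (lt_le_trans (as_ n) sy) (le_lt_trans yt tb).
  have iQ : mu.-integrable `[s n, t] (EFin \o derive1 Q).
    apply: ge0_integrable_derive1 => //.
    - by move=> y /D/dQ.
    - by move=> y /D/Q0.
    - by apply: measurable_funS mQ => //; exact: subset_trans sub.
  rewrite -(@Rintegral_derive1 _ Q (s n) t)//.
    by rewrite /Rintegral fineK//; exact: integrable_fin_num iQ.
  by move=> y /D/dQ.
have UE : `]a, t] = \bigcup_n `[s n, t].
  apply/seteqP; split => [y /=|y [n _ /subn]//].
  rewrite in_itv/= => /andP[ay yt].
  have ya0 : 0 < (y - a) / (t - a) by rewrite divr_gt0// subr_gt0.
  have [n _ /(_ n (leqnn n))/= Hn] := near_infty_natSinv_lt (PosNum ya0).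
  exists n => //=; rewrite in_itv/= yt andbT /s -lerBrDl.
  by move: Hn; rewrite ltr_pdivlMr// mulrC => /ltW.
have s_a : s n @[n --> \oo] --> a.
  rewrite -[X in _ --> X]addr0; apply: cvgD; first exact: cvg_cst.
  rewrite -[X in _ --> X](mulr0 (t - a)); apply: cvgMr.
  exact: cvg_harmonic.
have Qs : (Q t - Q (s n))%:E @[n --> \oo] --> (Q t)%:E.
  apply: cvg_EFin; first exact: nearW.
  rewrite /= -[X in _ --> X]subr0; apply: cvgB; first exact: cvg_cst.
  by move/cvg_at_rightP : Qa; apply.
have := @ge0_nondecreasing_set_cvg_integral _ (measurableTypeR R) _
  (fun n => `[s n, t]%classic)
  (EFin \o derive1 Q) mu.
rewrite -UE => H; apply/esym.
have {}H : (\int[mu]_(u in `[s n, t]) (EFin \o derive1 Q) u)%E @[n --> \oo] -->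
           (\int[mu]_(u in `]a, t]) (EFin \o derive1 Q) u)%E.
  apply: H => //.
  - apply/nondecreasing_seqP => n; rewrite subsetEset.
    apply: subset_itvr; rewrite bnd_simp lerD2l.
    by rewrite ler_pM2l// lef_pV2 ?posrE// ler_nat.
  - move=> n; apply/measurable_EFinP; apply: measurable_funS mQ => //.
    exact: subset_trans sub.
  - move=> n y /subn/sub; rewrite /= in_itv/= => /Q0.
    by rewrite lee_fin.
rewrite -(cvg_lim (@ereal_hausdorff R) Qs) -(cvg_lim (@ereal_hausdorff R) H).
by congr (limn _); apply/funext => n; rewrite stE.
Qed.

End open_interval.

Section triangle.
Context {R : realType}.
Local Notation mu := (@lebesgue_measure R).
Variables (a b : R) (w psi W : R -> R).
Hypothesis mw : measurable_fun `]a, b[ w.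
Hypothesis w0 : forall u, a < u < b -> 0 <= w u.
Hypothesis mpsi : measurable_fun `]a, b[ psi.
Hypothesis wW : forall t, a < t < b ->
  (\int[mu]_(u in `]a, t]) (w u)%:E = (W t)%:E)%E.
Hypothesis ipsi : forall u, a < u < b -> mu.-integrable `[u, b[ (EFin \o psi).
Hypothesis ipsiW : mu.-integrable `]a, b[ (EFin \o (fun t => psi t * W t)).

Let D : set R := `]a, b[.
(* The indicator of the triangle and the extensions by 0 of w and psi make
   (u, t) |-> w u * psi t a function on the whole plane. *)
Let T (u t : R) := [&& a < u, u <= t & t < b].
Let f (z : R * R) : \bar R :=
  (if z.1 <= z.2 then (w \_ D) z.1 * (psi \_ D) z.2 else 0)%:E.

Let fE u t : f (u, t) = (if T u t then w u * psi t else 0)%:E.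
Proof.
rewrite /f /T /=; case: ifPn => ut; last by rewrite andbF.
rewrite !patchE /D !mem_setE /= !in_itv/=.
case: (ltP a u) => au /=; last by rewrite mul0r.
case: (ltP t b) => tb /=; last by rewrite andbF mulr0.
by rewrite (le_lt_trans ut tb) (lt_le_trans au ut).
Qed.

Let mf : measurable_fun setT f.
Proof.
have mwD : measurable_fun setT (w \_ D).
  by apply/(measurable_restrictT w); first exact: measurable_itv.
have mpD : measurable_fun setT (psi \_ D).
  by apply/(measurable_restrictT psi); first exact: measurable_itv.
apply/measurable_EFinP; apply: measurable_fun_ifT => //.
- exact: measurable_fun_ler.
- apply: measurable_funM; first exact: (measurableT_comp mwD measurable_fst).
  exact: (measurableT_comp mpD measurable_snd).
Qed.

Let W0 t : a < t < b -> 0 <= W t.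
Proof.
move=> tab; rewrite -lee_fin -wW//; apply: integral_ge0 => u /=.
rewrite in_itv/= lee_fin => /andP[au ut]; rewrite w0// au.
by case/andP: tab => _; exact: le_lt_trans.
Qed.

Let iw t : a < t < b -> mu.-integrable `]a, t] (EFin \o w).
Proof.
move=> /[dup] tab /andP[_ tb]; apply/integrableP; split.
  apply/measurable_EFinP; apply: measurable_funS mw => //.
  by apply: subset_itvl; rewrite bnd_simp.
under eq_integral => u.
  rewrite inE/= in_itv/= => /andP[au ut].
  rewrite ger0_norm; last by rewrite w0// au (le_lt_trans ut).
  over.
by rewrite wW// ltry.
Qed.

Let int_t u : (\int[mu]_t f (u, t) =
  ((fun u => (w u * \int[mu]_(t in `[u, b[) psi t)%:E) \_ D) u)%E.
Proof.
rewrite patchE /D mem_setE /= in_itv/=; case: ifPn => [uab|uab].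
  have /andP[au ub] := uab.
  rewrite EFinM /Rintegral fineK; last exact: integrable_fin_num (ipsi uab).
  rewrite -integralZl//; last exact: ipsi.
  rewrite [RHS]integral_mkcond; apply: eq_integral => t _.
  rewrite fE /T au/= patchE mem_setE /= in_itv/=.
  by case: ifPn.
apply: integral0_eq => t _; rewrite fE /T; case: ifPn => // /and3P[au ut tb].
by move: uab; rewrite au (le_lt_trans ut tb).
Qed.

Let int_u_norm t : (\int[mu]_u `|f (u, t)| =
  ((fun t => `|(psi t * W t)%:E|) \_ D) t)%E.
Proof.
under eq_integral do rewrite fE.
rewrite patchE /D mem_setE /= in_itv/=; case: ifPn => [tab|tab].
  have /andP[at_ tb] := tab.
  rewrite normrM (ger0_norm (W0 tab)) EFinM -wW// -integralZl//; last exact: iw.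
  rewrite [RHS]integral_mkcond; apply: eq_integral => u _.
  rewrite /T tb andbT patchE mem_setE /= in_itv/=.
  case: ifPn => [/andP[au ut]|_]; last by rewrite normr0.
  by rewrite normrM mulrC (ger0_norm (w0 _))// au (le_lt_trans ut).
apply: integral0_eq => u _; rewrite /T; case: ifPn => [/and3P[au ut tb]|].
  by move: tab; rewrite tb (lt_le_trans au ut).
by rewrite normr0.
Qed.

Let int_u t : (\int[mu]_u f (u, t) = ((fun t => (psi t * W t)%:E) \_ D) t)%E.
Proof.
rewrite patchE /D mem_setE /= in_itv/=; case: ifPn => [tab|tab].
  have /andP[at_ tb] := tab.
  rewrite EFinM -wW// -integralZl//; last exact: iw.
  rewrite [RHS]integral_mkcond; apply: eq_integral => u _.
  rewrite fE /T tb andbT patchE mem_setE /= in_itv/=.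
  by case: ifPn => [/andP[au ut]|//]; rewrite mulrC.
apply: integral0_eq => u _; rewrite fE /T; case: ifPn => // /and3P[au ut tb].
by move: tab; rewrite tb (lt_le_trans au ut).
Qed.

(* Integrability is tested with the inner integral over u: as w is nonnegative,
   that of the modulus is |psi t| W t. *)
Let if_ : (mu \x mu)%E.-integrable setT f.
Proof.
apply/integrable21ltyP; first exact: mf.
under eq_integral do rewrite int_u_norm.
rewrite -integral_mkcond.
by have /integrableP[] := ipsiW.
Qed.

Lemma integrable_triangle : mu.-integrable `]a, b[
  (EFin \o (fun u => w u * \int[mu]_(t in `[u, b[) psi t)).
Proof.
have := integrable_fubini_F if_; rewrite /fubini_F.
under eq_fun do rewrite int_t.
by move=> H; apply/integrable_mkcond; [exact: measurable_itv|exact: H].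
Qed.

Lemma integral_triangle :
  (\int[mu]_(u in `]a, b[) (w u * \int[mu]_(t in `[u, b[) psi t)%:E =
   \int[mu]_(t in `]a, b[) (psi t * W t)%:E)%E.
Proof.
rewrite [LHS]integral_mkcond [RHS]integral_mkcond.
under [LHS]eq_integral do rewrite -int_t.
under [RHS]eq_integral do rewrite -int_u.
exact: Fubini.
Qed.

End triangle.

(** * Integration against the density of Q *)

Section taylor_term.
Context {R : realType}.

Lemma is_derive_onemX (x : R) k :
  is_derive x (1 : R) (fun u : R => (1 - u) ^+ k.+1) (- (k.+1%:R * (1 - x) ^+ k)).
Proof.
have := is_deriveX k.+1 (is_deriveB (is_derive_cst (1 : R) x (1 : R)) (is_derive_id x (1 : R))).
rewrite exprfctE /= sub0r [_ *: _]mulrN1; exact.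
Qed.

(** The primitive vanishes at 1 when f is bounded there, so that its increment from u
to 1 is the term itself; its derivative is the difference of two consecutive
terms, which is what telescopes. *)
Lemma is_derive_taylor_term (f : R -> R) (x : R) k : derivable f x 1 ->
  is_derive x (1 : R) (fun u => - ((k.+1)`!%:R^-1 * (f u * (1 - u) ^+ k.+1)))
    ((k`!)%:R^-1 * (f x * (1 - x) ^+ k)
     - (k.+1)`!%:R^-1 * (derive1 f x * (1 - x) ^+ k.+1)).
Proof.
move=> df.
have := is_deriveN (is_deriveZ (k.+1)`!%:R^-1
  (is_deriveM (derivableP df) (is_derive_onemX x k))).
move=> h; apply: (is_derive_eq h).
rewrite -derive1E.
transitivity (- ((k.+1)`!%:R^-1 * (f x * (- (k.+1%:R * (1 - x) ^+ k)) +
    (1 - x) ^+ k.+1 * derive1 f x))); first by [].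
rewrite factS natrM.
have k0 : (k`!%:R : R) != 0 by rewrite pnatr_eq0 -lt0n fact_gt0.
have k1 : (k.+1%:R : R) != 0 by rewrite pnatr_eq0.
by field; rewrite k0 addrC natr1 k1.
Qed.

End taylor_term.

Section weighted.
Context {R : realType}.
Local Notation mu := (@lebesgue_measure R).
Local Notation I01 := (`](0 : R), 1[%classic).

Variable Q : R -> R.
Hypothesis dQ : forall u : R, 0 < u < 1 -> derivable Q u 1.
Hypothesis ndQ : forall u v : R, 0 < u -> u <= v -> v < 1 -> Q u <= Q v.
Hypothesis Q_gt0 : forall u : R, 0 < u < 1 -> 0 < Q u.
Hypothesis Q_0 : Q u @[u --> 0^'+] --> (0 : R).
Hypothesis iQ : mu.-integrable I01 (EFin \o Q).

Let mQ : measurable_fun I01 Q.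
Proof. exact: measurable_derivable_itv. Qed.

Section one_function.
Variable G : R -> R.
Hypothesis dG : forall u : R, 0 < u < 1 -> derivable G u 1.
Hypothesis iGQ : mu.-integrable I01 (EFin \o (fun u => derive1 G u * Q u)).

Let mdG : measurable_fun I01 (derive1 G).
Proof. exact: measurable_derive1_itv. Qed.

Let sub1 (u : R) : 0 < u -> `[u, 1[ `<=` I01.
Proof. by move=> u0; apply: subset_itvr; rewrite bnd_simp. Qed.

(** On [u, 1[ the weight Q is at least Q u > 0. *)
Lemma weighted_integrable_right (u : R) : 0 < u < 1 ->
  mu.-integrable `[u, 1[ (EFin \o derive1 G).
Proof.
move=> u01; have /andP[u0 u1] := u01.
have iZ : mu.-integrable `[u, 1[
    (fun t => (Q u)^-1%:E * (derive1 G t * Q t)%:E)%E.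
  by apply: integrableZl => //; apply: integrableS iGQ => //; exact: sub1.
apply: le_integrable iZ; first exact: measurable_itv.
  apply/measurable_EFinP; apply: measurable_funS mdG => //; exact: sub1.
move=> t; rewrite /= in_itv/= => /andP[ut t1].
have Qu := Q_gt0 u01.
have Qut : Q u <= Q t by exact: ndQ.
rewrite lee_fin normrM normfV normrM (gtr0_norm Qu).
rewrite mulrCA ler_peMr// mulrC ler_pdivlMr// mul1r.
by rewrite (le_trans Qut)// ler_norm.
Qed.

Lemma weighted_cvg_left (u : R) : 0 < u < 1 ->
  G v @[v --> 1^'-] --> G u + \int[mu]_(t in `[u, 1[) derive1 G t.
Proof.
move=> /[dup] u01 /andP[u0 u1]; apply: cvg_at_left_derive1_integral => //.
  by move=> y /andP[uy y1]; apply: dG; rewrite y1 (lt_le_trans u0).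
exact: weighted_integrable_right.
Qed.

Let l := lim (G v @[v --> 1^'-]).

Lemma weighted_cvg_lim : G v @[v --> 1^'-] --> l.
Proof.
have h : 0 < (2^-1 : R) < 1 by rewrite invr_gt0 ltr0n invf_lt1// ltr1n.
by apply/cvg_ex; eexists; exact: weighted_cvg_left h.
Qed.

Lemma weighted_integral_right (u : R) : 0 < u < 1 ->
  \int[mu]_(t in `[u, 1[) derive1 G t = l - G u.
Proof.
move=> u01; rewrite /l (cvg_lim _ (weighted_cvg_left u01))//.
by rewrite [RHS]addrC addKr.
Qed.

Let q0 (u : R) : 0 < u < 1 -> 0 <= derive1 Q u.
Proof. by move=> u01; apply: nondecreasing_derive1_ge0 ndQ u01 (dQ u01). Qed.

Let triangleQ : forall t : R, 0 < t < 1 ->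
  (\int[mu]_(u in `]0%R, t]) (derive1 Q u)%:E = (Q t)%:E)%E.
Proof. by move=> t t01; apply: integral_derive1_from_left t01 dQ q0 Q_0. Qed.

Lemma weighted_integrable :
  mu.-integrable I01 (EFin \o (fun u => (l - G u) * derive1 Q u)).
Proof.
have := integrable_triangle (measurable_derive1_itv dQ) q0 mdG triangleQ
  weighted_integrable_right iGQ.
apply: eq_integrable => // u; rewrite inE/= in_itv/= => u01.
by rewrite weighted_integral_right// mulrC.
Qed.

(** Both sides are iterated integrals of q(u) G'(t) over the triangle u <= t. *)
Lemma weighted_integral :
  \int[mu]_(u in I01) ((l - G u) * derive1 Q u) =
  \int[mu]_(u in I01) (derive1 G u * Q u).
Proof.
rewrite /Rintegral -(integral_triangle (measurable_derive1_itv dQ) q0 mdG triangleQ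
  weighted_integrable_right iGQ).
congr fine; apply: eq_integral => u; rewrite inE/= in_itv/= => u01.
by rewrite weighted_integral_right// mulrC.
Qed.

(** |l - G u| Q u is at most the integral of |G'| Q over [u, 1[, because Q u <= Q t
there.  So G Q is dominated by a constant plus |l| Q. *)
Lemma weighted_integrable_primitive :
  mu.-integrable I01 (EFin \o (fun u => G u * Q u)).
Proof.
pose C := \int[mu]_(u in I01) `|derive1 G u * Q u|.
have mGQ : measurable_fun I01 (fun u => G u * Q u).
  by apply: measurable_funM => //; exact: measurable_derivable_itv.
have iC : mu.-integrable I01 (EFin \o (fun u => C + `|l| * Q u)).
  apply: (@eq_integrable _ _ _ mu _ _ (EFin \o cst C \+ (fun u => `|l|%:E * (EFin \o Q) u)%E)).
  - exact: measurable_itv.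
  - by move=> u _; rewrite /= EFinD EFinM.
  - apply: integrableD; first exact: measurable_itv.
    + apply: measurable_bounded_integrable => //; last exact: bounded_cst.
      by rewrite /= lebesgue_measure_itv/= lte_fin ltr01 -EFinB ltry.
    + by apply: integrableZl => //; exact: measurable_itv.
apply: le_integrable iC; [exact: measurable_itv|exact/measurable_EFinP|].
move=> u; rewrite /= in_itv/= => u01; have /andP[u0 u1] := u01.
have Qu := Q_gt0 u01.
rewrite lee_fin; apply: le_trans (ler_norm _).
have -> : G u * Q u = l * Q u - (l - G u) * Q u by ring.
rewrite (le_trans (ler_normB _ _))// normrM (gtr0_norm Qu) addrC lerD2r//.
rewrite -weighted_integral_right// mulrC -RintegralZl//; last first.
  exact: weighted_integrable_right.
have iuG := weighted_integrable_right u01.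
have inG : mu.-integrable `[u, 1[ (EFin \o (fun t => `|derive1 G t * Q t|)).
  by apply: integrableS (integrable_norm iGQ) => //; exact: sub1.
have iQG : mu.-integrable `[u, 1[ (EFin \o (fun t => Q u * derive1 G t)).
  rewrite (_ : EFin \o _ = (fun t => (Q u)%:E * (EFin \o derive1 G) t)%E)//.
  by apply: integrableZl => //; exact: measurable_itv.
have step1 : `|\int[mu]_(t in `[u, 1[) (Q u * derive1 G t)| <=
    \int[mu]_(t in `[u, 1[) `|Q u * derive1 G t|.
  by apply: le_normr_Rintegral => //; exact: measurable_itv.
have step2 : \int[mu]_(t in `[u, 1[) `|Q u * derive1 G t| <=
    \int[mu]_(t in `[u, 1[) `|derive1 G t * Q t|.
  apply: le_Rintegral => //; first exact: integrable_norm iQG.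
  move=> t; rewrite /= in_itv/= => /andP[ut t1].
  rewrite [leLHS]normrM [leRHS]normrM mulrC ler_wpM2l// (gtr0_norm Qu).
  by rewrite (le_trans _ (ler_norm _))// ndQ.
have step3 : \int[mu]_(t in `[u, 1[) `|derive1 G t * Q t| <= C.
  apply: fine_le.
  - exact: integrable_fin_num inG.
  - exact: integrable_fin_num (integrable_norm iGQ).
  - apply: ge0_subset_integral => //.
    + exact: measurable_int (integrable_norm iGQ).
    + exact: sub1.
by rewrite (le_trans step1)// (le_trans step2).
Qed.

End one_function.

Lemma weighted_integrable_onemX (f : R -> R) k : measurable_fun I01 f ->
  mu.-integrable I01 (EFin \o (fun u => f u * Q u)) ->
  mu.-integrable I01 (EFin \o (fun u => f u * (1 - u) ^+ k * Q u)).
Proof.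
move=> mf; apply: le_integrable; first exact: measurable_itv.
  apply/measurable_EFinP; apply: measurable_funM => //.
  apply: measurable_funM => //; apply: measurable_funX.
  exact: measurable_funB.
move=> u; rewrite /= in_itv/= => /andP[u0 u1]; rewrite lee_fin !normrM.
rewrite ler_wpM2r// ler_piMr// normrX exprn_ile1// ger0_norm; lra.
Qed.

Section taylor.
Variables (g : R -> R) (n : nat).
Hypothesis n_gt0 : (0 < n)%N.
Hypothesis dg : forall k, (k < n)%N -> forall u : R, 0 < u < 1 -> derivable (derive1n k g) u 1.
Hypothesis igQ : mu.-integrable I01 (EFin \o (fun u => derive1n n g u * Q u)).

(** Descent from n: each step passes from a derivative to its primitive. *)
Lemma weighted_integrable_derive1n k : (k <= n)%N ->
  mu.-integrable I01 (EFin \o (fun u => derive1n k g u * Q u)).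
Proof.
suff H j : (j <= n)%N ->
    mu.-integrable I01 (EFin \o (fun u => derive1n (n - j) g u * Q u)).
  by move=> kn; have := H (n - k)%N (leq_subr _ _); rewrite subKn.
elim: j => [_|j IH jn]; first by rewrite subn0.
have E : (n - j = (n - j.+1).+1)%N by rewrite -subSn.
apply: weighted_integrable_primitive.
  by apply: dg; rewrite -E leq_subr.
have := IH (ltnW jn); rewrite E; exact.
Qed.

Lemma measurable_derive1n k : (k <= n)%N -> measurable_fun I01 (derive1n k g).
Proof.
rewrite leq_eqVlt => /predU1P[->|kn].
  case: n n_gt0 dg => // m _ dgm.
  by apply: (measurable_derive1_itv (dgm m _)).
by apply: measurable_derivable_itv; exact: dg.
Qed.

(** For k < n this is the integral, against q, of the integral remainder of order k of
the Taylor expansion of g at 1. *)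
Definition taylor_remainder k : R :=
  k`!%:R^-1 * \int[mu]_(u in I01) (derive1n k.+1 g u * (1 - u) ^+ k * Q u).

Section term.
Variable k : nat.
Hypothesis kn : (k.+1 < n)%N.

Let f := derive1n k.+1 g.
(* The primitive whose derivative is the difference of the integrands of the
   remainders of orders k and k.+1. *)
Let G u := - ((k.+1)`!%:R^-1 * (f u * (1 - u) ^+ k.+1)).

Let dfx (u : R) : 0 < u < 1 -> derivable f u 1. Proof. exact: dg. Qed.

Let dG (u : R) : 0 < u < 1 -> derivable G u 1.
Proof. by move=> u01; have [] := is_derive_taylor_term k (dfx u01). Qed.

Let i0 : mu.-integrable I01 (EFin \o (fun u => f u * (1 - u) ^+ k * Q u)).
Proof.
apply: weighted_integrable_onemX; first exact: measurable_derive1n (ltnW kn).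
exact: weighted_integrable_derive1n (ltnW kn).
Qed.

Let i1 : mu.-integrable I01
  (EFin \o (fun u => derive1 f u * (1 - u) ^+ k.+1 * Q u)).
Proof.
apply: weighted_integrable_onemX; first exact: measurable_derive1n kn.
exact: weighted_integrable_derive1n kn.
Qed.

Let GQE (u : R) : 0 < u < 1 -> derive1 G u * Q u =
  (k`!)%:R^-1 * (f u * (1 - u) ^+ k * Q u)
  - (k.+1)`!%:R^-1 * (derive1 f u * (1 - u) ^+ k.+1 * Q u).
Proof.
move=> u01; have dGu := is_derive_taylor_term k (dfx u01).
by rewrite derive1E derive_val mulrBl -!mulrA.
Qed.

Let iGQ : mu.-integrable I01 (EFin \o (fun u => derive1 G u * Q u)).
Proof.
have mI : measurable I01 by exact: measurable_itv.
have := integrable_subr mI (integrable_scalel (k`!)%:R^-1 mI i0)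
  (integrable_scalel (k.+1)`!%:R^-1 mI i1).
apply: eq_integrable => // u; rewrite inE/= in_itv/= => u01.
by rewrite GQE.
Qed.

Let limG : lim (G u @[u --> 1^'-]) = 0.
Proof.
apply: cvg_lim => //.
have fl : f u @[u --> 1^'-] --> lim (f u @[u --> 1^'-]).
  exact: weighted_cvg_lim dfx (weighted_integrable_derive1n kn).
rewrite -oppr0; apply: cvgN; rewrite -(mulr0 (k.+1)`!%:R^-1); apply: cvgMr.
rewrite -(mulr0 (lim (f u @[u --> 1^'-]))); apply: cvgM => //.
have -> : (0 : R) = (1 - 1) ^+ k.+1 by rewrite subrr expr0n.
have [/derivable1_diffP/differentiable_continuous cont _] := is_derive_onemX (1 : R) k.
by apply: cvg_at_left_filter; exact: cont.
Qed.

Let GE u : (lim (G v @[v --> 1^'-]) - G u) * derive1 Q u =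
  (k.+1)`!%:R^-1 * (f u * (1 - u) ^+ k.+1 * derive1 Q u).
Proof. by rewrite limG sub0r opprK -!mulrA. Qed.

Lemma taylor_term_integrable : mu.-integrable I01
  (EFin \o (fun u => derive1n k.+1 g u * (1 - u) ^+ k.+1 * derive1 Q u)).
Proof.
have mI : measurable I01 by exact: measurable_itv.
have := integrable_scalel (k.+1)`!%:R mI (weighted_integrable dG iGQ).
apply: eq_integrable => // u _.
by rewrite /= GE mulVKf// pnatr_eq0 -lt0n fact_gt0.
Qed.

Lemma taylor_term_integral :
  (k.+1)`!%:R^-1 *
    \int[mu]_(u in I01) (derive1n k.+1 g u * (1 - u) ^+ k.+1 * derive1 Q u) =
  taylor_remainder k - taylor_remainder k.+1.
Proof.
have mI : measurable I01 by exact: measurable_itv.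
rewrite /taylor_remainder -!RintegralZl//; last exact: taylor_term_integrable.
rewrite -RintegralB//; last 2 first.
- exact: integrable_scalel i0.
- exact: integrable_scalel i1.
transitivity (\int[mu]_(u in I01) (derive1 G u * Q u)); last first.
  by apply: eq_Rintegral => u; rewrite inE/= in_itv/= => /GQE.
rewrite -(weighted_integral dG iGQ).
by apply: eq_Rintegral => u _; rewrite GE.
Qed.
End term.

Let dg0 (u : R) : 0 < u < 1 -> derivable g u 1. Proof. exact: dg n_gt0 u. Qed.

Let ig1 : mu.-integrable I01 (EFin \o (fun u => derive1 g u * Q u)).
Proof. exact: weighted_integrable_derive1n n_gt0. Qed.

Let l := lim (g u @[u --> 1^'-]).

Lemma taylor_cvg : g u @[u --> 1^'-] --> l.
Proof. exact: weighted_cvg_lim dg0 ig1. Qed.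

Lemma taylor_integrable :
  mu.-integrable I01 (EFin \o (fun u => (l - g u) * derive1 Q u)).
Proof. exact: weighted_integrable dg0 ig1. Qed.

Lemma taylor_integral :
  \int[mu]_(u in I01) ((l - g u) * derive1 Q u) =
  \sum_(1 <= k < n) k`!%:R^-1 *
      \int[mu]_(u in I01) (derive1n k g u * (1 - u) ^+ k * derive1 Q u)
  + n.-1`!%:R^-1 *
      \int[mu]_(u in I01) (derive1n n g u * (1 - u) ^+ n.-1 * Q u).
Proof.
have -> : \int[mu]_(u in I01) ((l - g u) * derive1 Q u) = taylor_remainder 0.
  rewrite (weighted_integral dg0 ig1) /taylor_remainder fact0 invr1 mul1r.
  by apply: eq_Rintegral => u _; rewrite expr0 mulr1.
have -> : n.-1`!%:R^-1 * \int[mu]_(u in I01)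
    (derive1n n g u * (1 - u) ^+ n.-1 * Q u) = taylor_remainder n.-1.
  by rewrite /taylor_remainder prednK.
rewrite big_add1.
rewrite (@telescope_sumr_eq _ _ _ (fun k => - taylor_remainder k)) => // [|k /andP[_ kn]].
  by rewrite opprK addrAC addNr add0r.
by rewrite taylor_term_integral ?opprK 1?addrC// -ltn_predRL.
Qed.

End taylor.
End weighted.

(** * Quantile functions *)

Section quantile_facts.
Context d (T : measurableType d) (R : realType) (P : probability T R).
Variable X : {RV P >-> R}.

Let S (u : R) : set R := [set x | (u%:E <= cdf X x)%E].

Let cdf_fin x : cdf X x \is a fin_num.
Proof. by rewrite /cdf fin_num_measure. Qed.

Lemma quantile_has_inf (u : R) : 0 < u < 1 -> has_inf (S u).
Proof.
move=> /andP[u0 u1]; split.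
  have /cvgr_ge/(_ _ u1) H : (fine \o cdf X) x @[x --> +oo] --> (1 : R).
    exact: fine_cvg (cvg_cdfy1 X).
  by have [x xu] := filter_ex H; exists x; rewrite /S/= -(fineK (cdf_fin x)) lee_fin.
have /cvgr_lt/(_ _ u0) H : (fine \o cdf X) x @[x --> -oo] --> (0 : R).
  exact: fine_cvg (cvg_cdfNy0 X).
have [m mu] := filter_ex H; exists m => x Sx; rewrite leNgt; apply/negP => xm.
have : (u%:E <= cdf X m)%E by apply: le_trans Sx _; exact/cdf_nondecreasing/ltW.
by rewrite -(fineK (cdf_fin m)) lee_fin leNgt mu.
Qed.

Lemma nondecreasing_quantile (u v : R) : 0 < u -> u <= v -> v < 1 ->
  quantile X u <= quantile X v.
Proof.
move=> u0 uv v1.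
have [_ lbu] : has_inf (S u) by apply: quantile_has_inf; rewrite u0 (le_lt_trans uv).
have [v0 _] : has_inf (S v) by apply: quantile_has_inf; rewrite v1 (lt_le_trans u0).
apply: lb_le_inf v0 _ => x Sx; apply: ge_inf => //.
by apply: le_trans Sx; rewrite lee_fin.
Qed.

Hypothesis hX : in_classD X.

(** Q is nondecreasing with limit 0 at 0. *)
Lemma quantile_ge0 (u : R) : 0 < u < 1 -> 0 <= quantile X u.
Proof.
move=> /andP[u0 u1]; apply: cvgr_to_le (classD_quantile0 hX) _.
near=> v; apply: nondecreasing_quantile => //.
by near: v; exact: nbhs_right_le.
Unshelve. all: by end_near. Qed.

(** If the cdf were positive at some x < 0, then Q would be at most x at every level
below that value, hence negative. *)
Lemma cdf_lt0 (x : R) : x < 0 -> cdf X x = 0%E.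
Proof.
move=> x0; apply/eqP; rewrite eq_le cdf_ge0 andbT leNgt; apply/negP => cx.
have c0 : 0 < fine (cdf X x) by rewrite -lte_fin fineK// cdf_fin.
pose v := Num.min (fine (cdf X x)) 2^-1.
have v01 : 0 < v < 1.
  rewrite lt_min c0 invr_gt0 ltr0n/=.
  by rewrite gt_min (_ : 2^-1 < 1 :> R) ?orbT// invf_lt1 ?ltr0n// ltr1n.
have Sx : S v x by rewrite /S/= -(fineK (cdf_fin x)) lee_fin ge_min lexx.
have := quantile_ge0 v01; rewrite leNgt => /negP; apply.
apply: le_lt_trans x0; apply: ge_inf Sx.
by have [_] := quantile_has_inf v01.
Qed.

(** The half-line ]-oo, 0] is the union of a point, which the law does not charge by
absolute continuity, and of half-lines that end at a negative number. *)
Lemma cdf0 : cdf X 0 = 0%E.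
Proof.
rewrite /cdf; apply: measure_negligible => //.
have -> : `]-oo, 0] = [set (0 : R)] `|` \bigcup_n `]-oo, - (n.+1%:R^-1 : R)].
  apply/seteqP; split => x /=.
    rewrite in_itv/= le_eqVlt => /predU1P[->|x0]; [by left|right].
    have x0' : 0 < - x by rewrite oppr_gt0.
    have [n _ /(_ n (leqnn n))/= Hn] := near_infty_natSinv_lt (PosNum x0').
    by exists n => //=; rewrite in_itv/= lerNr ltW.
  case=> [->|[n _ /=]]; rewrite !in_itv/= ?lexx//.
  by move=> /le_trans; apply; rewrite oppr_le0 invr_ge0.
apply: negligibleU.
  apply/negligibleP => //.
  have /null_content_dominatesP := classD_abs_cont hX; apply => //.
  exact: lebesgue_measure_set1.
apply: negligible_bigcup => n; apply/negligibleP => //.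
by apply: cdf_lt0; rewrite oppr_lt0 invr_gt0.
Qed.

(** Q u <= 0 would mean that the cdf is at least u at every positive point, hence at
0 by right continuity, where it vanishes. *)
Lemma quantile_gt0 (u : R) : 0 < u < 1 -> 0 < quantile X u.
Proof.
move=> /[dup] u01 /andP[u0 u1]; rewrite ltNge; apply/negP => Qu.
have : (u%:E <= cdf X 0)%E; last by rewrite cdf0 lee_fin leNgt u0.
apply: cvge_ge (@cdf_right_continuous _ _ _ P X 0).
near=> e.
have e0 : 0 < e by [].
have [x Sx xe] := inf_adherent e0 (quantile_has_inf u01).
apply: le_trans Sx _; apply: cdf_nondecreasing.
by rewrite (ltW (lt_le_trans xe _))// gerDr.
Unshelve. all: by end_near. Qed.

End quantile_facts.

(** * Expectations of functions of a variable with a density *)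

Section density_transfer.
Context d (T : measurableType d) (R : realType) (P : probability T R).
Local Notation mu := (@lebesgue_measure R).
Variables (Y : {RV P >-> R}) (f : R -> R).
Hypothesis Yf : has_density Y f.
Hypothesis mf : measurable_fun setT f.
Hypothesis f0 : forall x, 0 <= f x.

(** The law of Y is dominated by Lebesgue measure, and f agrees almost everywhere with
its Radon-Nikodym derivative because both have the same integrals over all
measurable sets. *)
Lemma ge0_integral_has_density (psi : R -> \bar R) :
  measurable_fun setT psi -> (forall x, 0 <= psi x)%E ->
  (\int[P]_w psi (Y w) = \int[mu]_x (psi x * (f x)%:E))%E.
Proof.
move=> mpsi psi0.
have mEf : measurable_fun setT (EFin \o f) by exact/measurable_EFinP.
(* Lebesgue measure lives on the copy of R whose sigma-algebra is presented as
   generated by intervals; the law of Y is transported there, so that both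
   measures are on the same measurable type. *)
have mY : measurable_fun setT (Y : T -> measurableTypeR R).
  by move=> _ B mB; exact: (@measurable_funPT _ _ _ _ Y measurableT B mB).
pose Y' : {RV P >-> measurableTypeR R} := MeasurableFun.Pack
  (MeasurableFun.Class (isMeasurableFun.Build _ _ _ _ _ mY)).
pose nu := distribution P Y'.
have dom : nu `<< mu.
  apply/null_content_dominatesP => A mA muA; rewrite [LHS](Yf mA).
  by apply: null_set_integral => //; exact: measurable_funTS.
transitivity (\int[nu]_x psi x)%E.
  by rewrite ge0_integral_distribution.
rewrite -[LHS](Radon_Nikodym_SigmaFinite.change_of_variables dom psi0 measurableT)//.
have mRN : measurable_fun setT (Radon_Nikodym_SigmaFinite.f nu mu).
  exact: measurable_int (Radon_Nikodym_SigmaFinite.f_integrable dom).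
apply: ae_eq_integral => //.
- exact: emeasurable_funM.
- exact: emeasurable_funM.
- apply: ae_eqe_mul2l; apply: integral_ae_eq => //.
    exact: Radon_Nikodym_SigmaFinite.f_integrable.
  move=> A _ mA; rewrite -Radon_Nikodym_SigmaFinite.f_integral//.
  exact: Yf.
Qed.

Variable phi : R -> R.
Hypothesis mphi : measurable_fun setT phi.
Hypothesis iphi : mu.-integrable setT (EFin \o (fun x => phi x * f x)).

Lemma integrable_has_density : P.-integrable setT (EFin \o (fun w => phi (Y w))).
Proof.
have mEphi : measurable_fun setT (EFin \o phi) by exact/measurable_EFinP.
apply/integrableP; split.
  by apply/measurable_EFinP; exact: measurableT_comp.
have := @ge0_integral_has_density (abse \o (EFin \o phi)).
move=> /= -> //; last exact: measurableT_comp.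
have /integrableP[_] := iphi; apply: le_lt_trans.
rewrite le_eqVlt; apply/orP; left; apply/eqP; apply: eq_integral => x _ /=.
by rewrite normrM (ger0_norm (f0 x)).
Qed.

Lemma integral_has_density :
  (\int[P]_w (phi (Y w))%:E = \int[mu]_x (phi x * f x)%:E)%E.
Proof.
have mEphi : measurable_fun setT (EFin \o phi) by exact/measurable_EFinP.
have mp := measurable_funepos mEphi.
have mn := measurable_funeneg mEphi.
rewrite [LHS]integralE [RHS]integralE; congr (_ - _)%E.
  transitivity (\int[P]_w (EFin \o phi)^\+ (Y w))%E.
    by apply: eq_integral => w _; rewrite !funeposE.
  rewrite ge0_integral_has_density//; apply: eq_integral => x _.
  by rewrite !funeposE /= maxe_pMl ?lee_fin// mul0e.
transitivity (\int[P]_w (EFin \o phi)^\- (Y w))%E.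
  by apply: eq_integral => w _; rewrite !funenegE.
rewrite ge0_integral_has_density//; apply: eq_integral => x _.
by rewrite !funenegE /= maxe_pMl ?lee_fin// mul0e -EFinM mulNr EFinN.
Qed.

End density_transfer.

Section density_transfer_01.
Context d (T : measurableType d) (R : realType) (P : probability T R).
Local Notation mu := (@lebesgue_measure R).
Local Notation I01 := (`](0 : R), 1[%classic).
Variables (Y : {RV P >-> R}) (f : R -> R).
Hypothesis Y01 : forall w, 0 < Y w < 1.
Hypothesis Yf : has_density Y f.
Hypothesis mf : measurable_fun setT f.
Hypothesis f0 : forall x, 0 <= f x.
Variable phi : R -> R.
Hypothesis mphi : measurable_fun I01 phi.
Hypothesis iphi : mu.-integrable I01 (EFin \o (fun x => phi x * f x)).

Let psi := phi \_ I01.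

Let psiY w : psi (Y w) = phi (Y w).
Proof. by rewrite /psi patchE mem_setE /= in_itv/= Y01. Qed.

Let psif : EFin \o (fun x => psi x * f x) = (EFin \o (fun x => phi x * f x)) \_ I01.
Proof.
by apply/funext => x; rewrite /psi /= !patchE; case: ifPn => // _; rewrite mul0r.
Qed.

Let mpsi : measurable_fun setT psi.
Proof. by apply/(measurable_restrictT phi); first exact: measurable_itv. Qed.

Let ipsi : mu.-integrable setT (EFin \o (fun x => psi x * f x)).
Proof.
have mI : measurable (I01 : set (measurableTypeR R)) by exact: measurable_itv.
by rewrite psif; apply/(integrable_mkcond _ mI).
Qed.

Lemma integrable_has_density01 :
  P.-integrable setT (EFin \o (fun w => phi (Y w))).
Proof.
have := integrable_has_density Yf mf f0 mpsi ipsi.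
by apply: eq_integrable => // w _ /=; rewrite psiY.
Qed.

Lemma expectation_has_density01 :
  ('E_P[fun w => phi (Y w)])%E = (\int[mu]_(x in I01) (phi x * f x))%:E.
Proof.
rewrite unlock /Rintegral fineK; last first.
  by apply: (integrable_fin_num _ iphi); exact: measurable_itv.
transitivity (\int[P]_w (psi (Y w))%:E)%E.
  by apply: eq_integral => w _; rewrite psiY.
rewrite (integral_has_density Yf mf f0 mpsi) [RHS]integral_mkcond.
by apply: eq_integral => x _; rewrite -psif.
Qed.

End density_transfer_01.

Section quantile_mean.
Context d (T : measurableType d) (R : realType) (P : probability T R).
Local Notation mu := (@lebesgue_measure R).
Local Notation I01 := (`](0 : R), 1[%classic).
Variable X : {RV P >-> R}.
Hypothesis hX : in_classD X.
Context dL (TL : measurableType dL) (PL : probability TL R).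
Variable XL : {RV PL >-> R}.

Let fL c (u : R) := if 0 < u < 1 then quantile X u / c else 0.

Let mQ : measurable_fun I01 (quantile X).
Proof. by apply: measurable_derivable_itv => u; exact: (classD_quantile_density hX). Qed.

Lemma lorenz_density_measurable c :
  measurable_fun setT (fun u : R => if 0 < u < 1 then quantile X u / c else 0).
Proof.
rewrite (_ : (fun _ => _) = (fun u => quantile X u / c) \_ I01).
  apply/(measurable_restrictT (fun u => quantile X u / c)); first exact: measurable_itv.
  exact: measurable_funM.
by apply/funext => u; rewrite patchE mem_setE /= in_itv.
Qed.

(** For c = E[X], Q / c is the derivative of the Lorenz curve of X.  If c were
negative or zero, the density would be nonpositive (it is 0 for c = 0,
as then c^-1 = 0), and could not have total mass 1. *)
Lemma lorenz_mass c : has_density XL (fL c) ->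
  0 < c /\ (\int[mu]_(u in I01) (quantile X u / c)%:E = 1)%E.
Proof.
move=> hL.
have mass : (\int[mu]_(u in I01) (quantile X u / c)%:E = 1)%E.
  have := hL _ measurableT; rewrite probability_setT => ->.
  rewrite [LHS]integral_mkcond; apply: eq_integral => u _.
  by rewrite patchE mem_setE /= in_itv/= /fL; case: ifPn.
split => //; rewrite ltNge; apply/negP => c0.
have : (\int[mu]_(u in I01) (quantile X u / c)%:E <= 0)%E.
  rewrite integralE integral0_eq ?sub0e ?oppe_le0 ?integral_ge0// => u.
  rewrite /= in_itv/= => u01; apply/eqP; rewrite funeposE eq_maxr// lee_fin.
  by rewrite mulr_ge0_le0 ?invr_le0// ltW// (quantile_gt0 hX).
by rewrite mass lee_fin leNgt ltr01.
Qed.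

Lemma integrable_quantile c : has_density XL (fL c) ->
  mu.-integrable I01 (EFin \o quantile X).
Proof.
move=> /lorenz_mass[c0 mass].
have i1 : mu.-integrable I01 (EFin \o (fun u => quantile X u / c)).
  apply/integrableP; split.
    by apply/measurable_EFinP; exact: measurable_funM.
  under eq_integral => u.
    rewrite inE/= in_itv/= => u01.
    rewrite ger0_norm; last by rewrite divr_ge0 ?ltW// (quantile_gt0 hX).
    over.
  by rewrite mass ltry.
have mI : measurable I01 by exact: measurable_itv.
have := integrable_scalel c mI i1.
by apply: eq_integrable => // u _; rewrite /= mulrCA divff ?mulr1// gt_eqF.
Qed.

End quantile_mean.

Lemma expectation_uniform01 (R : realType) d (T : measurableType d)
    (P : probability T R) (U : {RV P >-> R}) (phi : R -> R) :
  (forall w, 0 < U w < 1) -> has_density U (uniform_pdf 0 1) ->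
  (@lebesgue_measure R).-integrable `]0, 1[ (EFin \o phi) ->
  P.-integrable setT (EFin \o (fun w => phi (U w))) /\
  ('E_P[fun w => phi (U w)])%E =
    (\int[@lebesgue_measure R]_(u in `](0 : R), 1[) phi u)%:E.
Proof.
move=> U01 hU iphi.
have pdf1 (u : R) : 0 < u < 1 -> uniform_pdf 0 1 u = 1 :> R.
  by move=> /andP[u0 u1]; rewrite /uniform_pdf !ltW// subr0 invr1.
have pdf0 (u : R) : 0 <= uniform_pdf 0 1 u by exact: uniform_pdf_ge0 ltr01.
have mphi : measurable_fun `](0 : R), 1[ phi.
  by apply/measurable_EFinP; exact: measurable_int iphi.
have ipdf : (@lebesgue_measure R).-integrable `]0, 1[
    (EFin \o (fun u => phi u * uniform_pdf 0 1 u)).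
  apply: eq_integrable iphi; first exact: measurable_itv.
  by move=> u; rewrite inE/= in_itv/= => u01; rewrite /= pdf1// mulr1.
have mpdf := measurable_uniform_pdf (0 : R) 1.
have H1 := integrable_has_density01 U01 hU mpdf pdf0 mphi ipdf.
have H2 := expectation_has_density01 U01 hU mpdf pdf0 mphi ipdf.
split; first exact: H1.
rewrite H2; congr EFin.
by apply: eq_Rintegral => u; rewrite inE/= in_itv/= => u01; rewrite pdf1// mulr1.
Qed.

(** * The expansion *)

Theorem theorem2 (R : realType)
  (dX : measure_display) (TX : measurableType dX) (PX : probability TX R)
  (X : {RV PX >-> R}) (hX : in_classD X)
  (n : nat) (hn : (1 <= n)%N)
  (g : R -> R) (hg : n_differentiable01 n g)
  (hgQ : (@lebesgue_measure R).-integrable `]0, 1[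
           (EFin \o (fun u : R => derive1n n g u * quantile X u)))
  (dU : measure_display) (TU : measurableType dU) (PU : probability TU R)
  (U : {RV PU >-> R}) (hU01 : forall w : TU, 0 < U w < 1)
  (hU : forall A : set R, measurable A ->
          distribution PU U A = uniform_prob (@ltr01 R) A)
  (dL : measure_display) (TL : measurableType dL) (PL : probability TL R)
  (XL : {RV PL >-> R}) (hXL01 : forall w : TL, 0 < XL w < 1)
  (hXL : has_density XL
           (fun u : R => if 0 < u < 1 then quantile X u / fine 'E_PX[X] else 0)) :
  let q := quantile_density X in
  let g1 := lim (g u @[u --> 1^'-]) in
  let A := fun w : TU => (g1 - g (U w)) * q (U w) in
  let B := fun (k : nat) (w : TU) => derive1n k g (U w) * (1 - U w) ^+ k * q (U w) in
  let C := fun w : TL => derive1n n g (XL w) * (1 - XL w) ^+ n.-1 in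
  [/\ cvg (g u @[u --> 1^'-]),
      PU.-integrable [set: TU] (EFin \o A),
      forall k : nat, (1 <= k < n)%N -> PU.-integrable [set: TU] (EFin \o B k),
      PL.-integrable [set: TL] (EFin \o C) &
      ('E_PU[A] = \sum_(1 <= k < n) (k`!%:R^-1)%:E * 'E_PU[B k]
                 + (n.-1`!%:R^-1)%:E * 'E_PL[C] * 'E_PX[X])%E].
Proof.
move=> q g1 A B C.
pose Q := quantile X; pose c := fine ('E_PX[X])%E.
pose mu := @lebesgue_measure R.
have EX : ('E_PX[X])%E = c%:E.
  rewrite /c fineK// unlock; apply: integrable_fin_num => //.
  exact: (classD_mean hX).
have [c0 _] := lorenz_mass hX hXL.
have iQ : mu.-integrable `]0, 1[ (EFin \o Q) := integrable_quantile hX hXL.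
have dQ := classD_quantile_density hX.
have ndQ := @nondecreasing_quantile _ _ _ _ X.
have Q_gt0 := quantile_gt0 hX.
have Q_0 := classD_quantile0 hX.
have cvgg := taylor_cvg dQ ndQ Q_gt0 iQ hn hg hgQ.
(* hU says that U has density uniform_pdf: the uniform measure of a set is by
   definition the integral of that density over it. *)
have [iA EA] := expectation_uniform01 hU01 hU
  (taylor_integrable dQ ndQ Q_gt0 Q_0 iQ hn hg hgQ).
have hB k : (1 <= k < n)%N -> PU.-integrable setT (EFin \o B k) /\
    ('E_PU[B k])%E =
      (\int[mu]_(u in `](0 : R), 1[) (derive1n k g u * (1 - u) ^+ k * q u))%:E.
  case: k => // k /= kn; apply: (expectation_uniform01 hU01 hU).
  exact: (taylor_term_integrable dQ ndQ Q_gt0 Q_0 iQ hn hg hgQ kn).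
pose phi u := derive1n n g u * (1 - u) ^+ n.-1.
have mgn := measurable_derive1n hn hg (leqnn n).
have mphi : measurable_fun `](0 : R), 1[ phi.
  apply: measurable_funM => //; apply: measurable_funX.
  exact: measurable_funB.
have iphiQ := weighted_integrable_onemX dQ n.-1 mgn hgQ.
pose fL u := if 0 < u < 1 then Q u / c else 0.
have fL0 u : 0 <= fL u.
  by rewrite /fL; case: ifPn => // u01; rewrite divr_ge0// ltW// Q_gt0.
have fLE u : 0 < u < 1 -> phi u * fL u = c^-1 * (phi u * Q u).
  by move=> u01; rewrite /fL u01 mulrA mulrC.
have iphifL : mu.-integrable `]0, 1[ (EFin \o (fun u => phi u * fL u)).
  have mI : measurable `](0 : R), 1[ by exact: measurable_itv.
  have := integrable_scalel c^-1 mI iphiQ.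
  apply: eq_integrable => // u; rewrite inE/= in_itv/= => u01.
  by rewrite fLE.
have mfL := lorenz_density_measurable hX c.
have iC := integrable_has_density01 hXL01 hXL mfL fL0 mphi iphifL.
have EC := expectation_has_density01 hXL01 hXL mfL fL0 mphi iphifL.
split => //; first by move=> k /hB[].
rewrite [LHS]EA [X in (_ + _ * X * _)%E]EC EX.
rewrite (taylor_integral dQ ndQ Q_gt0 Q_0 iQ hn hg hgQ) EFinD; congr (_ + _)%E.
  rewrite -sumEFin; apply: eq_big_nat => k kn.
  by have [_ ->] := hB k kn; rewrite EFinM.
have -> : \int[mu]_(u in `](0 : R), 1[) (phi u * fL u) =
    c^-1 * \int[mu]_(u in `](0 : R), 1[) (phi u * Q u).
  rewrite -RintegralZl//.
  by apply: eq_Rintegral => u; rewrite inE/= in_itv/= => /fLE.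
rewrite -!EFinM; congr EFin.
by rewrite -mulrA mulrAC mulVf ?mul1r// gt_eqF.
Qed.
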